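(* Let $M$ be a compact metrizable space, $f\colon M\to M$ a homeomorphism, $R$ an equivalence relation on $M$ compatible with $f$, and $f_R\colon M_R\to M_R$ the quotient homeomorphism of $f$ by $R$. Then the following conditions are equivalent. (1) $f_R$ is expansive. (2) $f_R$ is a Lewowicz quotient of $f$; that is, there exist a metric $d$ on $M$ inducing the topology of $M$ and a constant $\alpha>0$ such that $f$ is $\alpha$-semi expansive with respect to $d$ and $R=R(d,\alpha)$.
   Context: An equivalence relation $R$ on $M$ (written $x\sim y$) is compatible with the homeomorphism $f$ if for all $x,y\in M$: $x\sim y$ if and only if $f(x)\sim f(y)$. $M_R=M/R$ is the quotient space with the quotient topology, $[x]$ is the class of $x$, and $f_R\colon M_R\to M_R$, $f_R[x]=[f(x)]$, is the induced homeomorphism. A homeomorphism $g\colon Y\to Y$ of a compact topological space $Y$ is expansive if $Y$ is metrizable and, for some (equivalently, any) metric $\rho$ inducing the topology of $Y$, there is $\alpha>0$ such that: $x,y\in Y$ and $\rho(g^n x,g^n y)\le\alpha$ for all $n\in\mathbb Z$ implies $x=y$. Given a metric $d$ inducing the topology of $M$ and $\alpha>0$, $f$ is $\alpha$-semi expansive (with respect to $d$) if: $x,y\in M$ and $d(f^nx,f^ny)\le\alpha$ for all $n\in\mathbb Z$ implies $d(x,y)<\alpha/2$. In that case $R(d,\alpha)$ denotes the equivalence relation on $M$ (compatible with $f$) given by: $x\sim y$ iff $d(f^nx,f^ny)\le\alpha$ for all $n\in\mathbb Z$. *)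

(* Defs.v *)
From HB Require Import structures.
From mathcomp Require Import all_boot all_order all_algebra generic_quotient.
From mathcomp Require Import all_classical all_reals all_analysis.

Set Implicit Arguments.
Unset Strict Implicit.
Unset Printing Implicit Defensive.

Import Order.TTheory GRing.Theory Num.Theory.

Local Open Scope classical_set_scope.
Local Open Scope quotient_scope.
Local Open Scope ring_scope.

Section metrics.
Context {R : realType} {T : topologicalType}.

(* The axioms are those of the library factory isMetric; nonnegativity follows
   from them.  A metric is kept as a plain function so that one can quantify
   over all metrics inducing the given topology of T. *)
Definition is_metric (d : T -> T -> R) : Prop :=
  [/\ forall x, d x x = 0,
      forall x y, d x y = 0 -> x = y,
      forall x y, d x y = d y x &
      forall y x z, d x z <= d x y + d y z].

Definition induces_topology (d : T -> T -> R) : Prop :=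
  forall A : set T, open A <->
    (forall x, A x -> exists2 r : R, 0 < r & [set y | d x y < r] `<=` A).

Definition compatible_metric (d : T -> T -> R) : Prop :=
  is_metric d /\ induces_topology d.

End metrics.

Definition metrizable (R : realType) (T : topologicalType) : Prop :=
  exists d : T -> T -> R, compatible_metric d.

Record homeo (T : topologicalType) := Homeo {
  homeo_fun :> T -> T;
  homeo_inv : T -> T;
  homeo_funK : cancel homeo_fun homeo_inv;
  homeo_invK : cancel homeo_inv homeo_fun;
  homeo_fun_continuous : continuous homeo_fun;
  homeo_inv_continuous : continuous homeo_inv }.

(* Negz n stands for - n.+1 *)
Definition iterz (T : topologicalType) (f : homeo T) (n : int) (x : T) : T :=
  match n with
  | Posz n => iter n f x
  | Negz n => iter n.+1 (homeo_inv f) x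
  end.

Definition expansive (R : realType) (Y : topologicalType) (g : homeo Y) : Prop :=
  exists2 rho : Y -> Y -> R, compatible_metric rho &
  exists2 alpha : R, 0 < alpha &
    forall x y, (forall n : int, rho (iterz g n x) (iterz g n y) <= alpha) ->
      x = y.

Section semi_expansive.
Context {R : realType} {M : topologicalType}.
Implicit Types (f : homeo M) (d : M -> M -> R) (alpha : R).

(* the relation R(d, alpha) *)
Definition orbit_close f d alpha (x y : M) : Prop :=
  forall n : int, d (iterz f n x) (iterz f n y) <= alpha.

Definition semi_expansive f d alpha : Prop :=
  forall x y, orbit_close f d alpha x y -> d x y < alpha / 2.

End semi_expansive.

Section quotient.
Context {M : topologicalType}.
Variables (E : equiv_rel M) (f : homeo M).

Definition compatible_rel : Prop := forall x y, E x y <-> E (f x) (f y).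

Definition quotient_space : topologicalType := quotient_topology {eq_quot E}.

Definition quotient_pi (x : M) : quotient_space :=
  \pi_(quotient_topology {eq_quot E}) x.

Definition quotient_lift (h : M -> M) (c : quotient_space) : quotient_space :=
  quotient_pi (h (repr c)).

Lemma quotient_piP x y : quotient_pi x = quotient_pi y <-> E x y.
Proof. by split=> [/eqmodP|Exy]; last exact/eqmodP. Qed.

Lemma quotient_piK (c : quotient_space) : quotient_pi (repr c) = c.
Proof. exact: reprK. Qed.

Lemma quotient_lift_pi (h : M -> M) : (forall x y, E x y -> E (h x) (h y)) ->
  forall x, quotient_lift h (quotient_pi x) = quotient_pi (h x).
Proof.
by move=> hE x; apply/quotient_piP/hE/quotient_piP; rewrite quotient_piK.
Qed.

Lemma quotient_lift_continuous (h : M -> M) :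
  (forall x y, E x y -> E (h x) (h y)) -> continuous h ->
  continuous (quotient_lift h).
Proof.
move=> hE ch; apply/quotient_continuous.
rewrite [X in continuous X](_ : _ = quotient_pi \o h); last first.
  by apply/funext => x /=; exact: quotient_lift_pi.
by move=> x; apply: continuous_comp; [exact: ch|exact: pi_continuous].
Qed.

Hypothesis Ef : compatible_rel.

Let fE x y : E x y -> E (f x) (f y). Proof. by move/Ef. Qed.

Let finvE x y : E x y -> E (homeo_inv f x) (homeo_inv f y).
Proof. by move=> Exy; apply/Ef; rewrite !homeo_invK. Qed.

Let quotient_liftK : cancel (quotient_lift f) (quotient_lift (homeo_inv f)).
Proof.
move=> c; rewrite -[c]quotient_piK (quotient_lift_pi fE).
by rewrite (quotient_lift_pi finvE) homeo_funK.
Qed.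

Let quotient_liftVK : cancel (quotient_lift (homeo_inv f)) (quotient_lift f).
Proof.
move=> c; rewrite -[c]quotient_piK (quotient_lift_pi finvE).
by rewrite (quotient_lift_pi fE) homeo_invK.
Qed.

Definition quotient_homeo : homeo quotient_space :=
  Homeo quotient_liftK quotient_liftVK
    (quotient_lift_continuous fE (@homeo_fun_continuous _ f))
    (quotient_lift_continuous finvE (@homeo_inv_continuous _ f)).

Lemma quotient_homeo_pi x : quotient_homeo (quotient_pi x) = quotient_pi (f x).
Proof. exact: quotient_lift_pi. Qed.

End quotient.

Definition lewowicz_quotient (R : realType) (M : topologicalType)
    (E : equiv_rel M) (f : homeo M) : Prop :=
  exists2 d : M -> M -> R, compatible_metric d &
  exists2 alpha : R, 0 < alpha &
    semi_expansive f d alpha /\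
    (forall x y, E x y <-> orbit_close f d alpha x y).

(* Main.v *)
(** If rho is a metric on the quotient for which f_R is expansive with constant
    alpha, and D is a metric on M, then d = rho(pi x, pi y) + min(D, alpha / 4)
    is compatible and exhibits R as R(d, alpha).
    Conversely, let U_n be the set of pairs that stay alpha-close during the
    times -n, ..., n.  The intersection of the U_n is R, so by compactness
    semi expansivity gives N with U_N inside {d < alpha / 2}, whence
    U_(n+N) o U_(n+N) is contained in U_n.  The U_n thus form a countable base
    of a uniformity on M; a pseudometric inducing it descends to a metric on the
    quotient, compatible by compactness, for which f_R is expansive because
    U_0 = {d <= alpha} is an entourage. *)

Require Import Defs.
From HB Require Import structures.
From mathcomp Require Import all_boot all_order all_algebra generic_quotient.
From mathcomp Require Import all_classical all_reals all_analysis.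
From mathcomp Require Import lra.

Set Implicit Arguments.
Unset Strict Implicit.
Unset Printing Implicit Defensive.

Import Order.TTheory GRing.Theory Num.Theory.
Import numFieldNormedType.Exports.

Local Open Scope classical_set_scope.
Local Open Scope ring_scope.

(** * Uniform structures and compactness *)

(** The [V n] generate a uniformity with a countable base, which is pseudometrizable. It need not be
    separated, so [delta] may vanish off the diagonal; this is what later lets it descend to a
    quotient. *)
Lemma pseudometric_of_countable_base (R : realType) (T : Type)
    (V : nat -> T -> T -> Prop) :
  (forall n x, V n x x) -> (forall n x y, V n x y -> V n y x) ->
  (forall n x y z, V n.+1 x y -> V n.+1 y z -> V n x z) ->
  exists delta : T -> T -> R,
    [/\ forall x, delta x x = 0,
        forall x y, delta x y = delta y x,
        forall y x z, delta x z <= delta x y + delta y z,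
        forall n, exists2 r, 0 < r & forall x y, delta x y < r -> V n x y &
        forall r, 0 < r -> exists n, forall x y, V n x y -> delta x y < r].
Proof.
move=> Vxx Vsym Vsplit.
have Vle n m x y : (n <= m)%N -> V m x y -> V n x y.
  elim: m => [|m IH]; first by rewrite leqn0 => /eqP->.
  by rewrite leq_eqVlt => /predU1P[->//|/IH + Vm]; apply; exact: Vsplit Vm _.
pose VV n : set (T * T) := [set xy | V n xy.1 xy.2].
pose ent : set_system (T * T) := filter_from [set: nat] VV.
have entF : Filter ent.
  apply: filter_from_filter; first by exists 0%N.
  move=> i j _ _; exists (maxn i j) => // -[x y] /= Vxy.
  by split; apply: Vle Vxy; rewrite ?leq_maxl ?leq_maxr.
have ent_refl A : ent A -> diagonal `<=` A.
  by case=> n _ VA [x y] /diagonalP /= ->; exact: VA.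
have ent_inv A : ent A -> ent A^-1%relation.
  by case=> n _ VA; exists n => // -[x y] /= /Vsym Vyx; exact: VA.
have ent_split A : ent A -> exists2 B, ent B & (B \; B)%relation `<=` A.
  case=> n _ VA; exists (VV n.+1); first by exists n.+1.
  by move=> [x z] /= [y Vxy Vyz]; apply: VA; exact: Vsplit Vxy Vyz.
pose T' : uniformType := HB.pack {classic T}
  (@isUniform.Build {classic T} ent entF ent_refl ent_inv ent_split).
have cT' : countable_uniformity T'.
  apply/countable_uniformityP; exists VV; last by move=> n; exists n.
  by move=> A [n _ VA]; exists n.
pose P : pseudoMetricType R := countable_uniform cT'.
(* Every ball of radius 2 is the whole space, so [edist] is finite and [fine] loses nothing. *)
have bounded x y : @ball R P x 2 y.
  exact: countable_uniform.countable_uniform_bounded.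
have fin x y : @edist R P (x, y) \is a fin_num.
  by apply/edist_finP; exists 2 => //; exact: bounded.
exists (fun x y => fine (@edist R P (x, y))); split.
- by move=> x; rewrite edist_refl.
- by move=> x y; rewrite edist_sym.
- move=> y x z; rewrite -fineD//; apply: fine_le => //.
    by rewrite fin_numD !fin.
  exact: edist_triangle.
- move=> n; have : @entourage P (VV n) by exists n.
  rewrite -entourage_ballE => -[r /= r0 rV]; exists r => // x y xyr.
  apply: (rV (x, y)); apply: (@edist_lt_ball R P r (x, y)).
  by rewrite -[edist _]fineK// lte_fin.
(* Membership in a ball bounds [edist] only non-strictly, hence the radius [r / 2]. *)
- move=> r r0; have [] : @entourage P [set xy | ball xy.1 (r / 2) xy.2].
    by rewrite -entourage_ballE; exists (r / 2) => //=; lra.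
  move=> n _ Vr; exists n => x y Vxy.
  rewrite -lte_fin fineK//; apply: (@le_lt_trans _ _ (r / 2)%:E).
    by apply: edist_fin; [lra|exact: (Vr (x, y))].
  by rewrite lte_fin; lra.
Qed.

(** The sets generate a proper filter; compactness gives it a cluster point, which lies in each
    closed [F n]. *)
Lemma compact_bigcap_neq0 (T : topologicalType) (F : nat -> set T) :
  compact [set: T] -> (forall n, closed (F n)) ->
  (forall n, F n.+1 `<=` F n) -> (forall n, F n !=set0) ->
  exists p, forall n, F n p.
Proof.
move=> cT cF dF F0.
have Fle n m : (n <= m)%N -> F m `<=` F n.
  elim: m => [|m IH]; first by rewrite leqn0 => /eqP->.
  rewrite leq_eqVlt => /predU1P[->//|/IH Fmn].
  exact: subset_trans (@dF m) _.
have FF : ProperFilter (filter_from [set: nat] F).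
  apply: filter_from_proper; last by move=> n _; exact: F0.
  apply: filter_from_filter; first by exists 0%N.
  move=> i j _ _; exists (maxn i j) => // x Fx.
  by split; apply: Fle Fx; rewrite ?leq_maxl ?leq_maxr.
have [p [_ pF]] : [set: T] `&` cluster (filter_from [set: nat] F) !=set0.
  by apply: cT; exists 0%N.
exists p => n; apply: cF => B /pF; apply; by exists n.
Qed.

(** * Compatible metrics *)

Section compatible_metric.
Context {R : realType} {T : topologicalType} (d : T -> T -> R).

Lemma is_metric_ge0 x y : is_metric d -> 0 <= d x y.
Proof.
by move=> [d0 _ dC dD]; have := dD y x x; rewrite d0 (dC y x); lra.
Qed.

Hypothesis cd : compatible_metric d.

Lemma nbhs_metric_ball (x : T) (r : R) : 0 < r -> nbhs x [set y | d x y < r].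
Proof.
have [[d0 _ _ dD] od] := cd; move=> r0; apply: open_nbhs_nbhs; split.
  apply/od => y /= xyr; exists (r - d x y); first by rewrite subr_gt0.
  by move=> z /= yz; have := dD y x z; lra.
by rewrite /= d0.
Qed.

Lemma metric_continuous : continuous (fun p : T * T => d p.1 p.2).
Proof.
have [[_ _ dC dD] _] := cd; move=> [a b]; apply/cvgrPdist_lt => e e0.
have e2 : 0 < e / 2 by lra.
exists ([set y | d a y < e / 2], [set y | d b y < e / 2]).
  by split; exact: nbhs_metric_ball.
move=> [x y] [/= ax byy]; rewrite ltr_norml; apply/andP.
have := dD x a b; have := dD y x b; have := dD a x y; have := dD b a y.
by rewrite (dC x a) (dC y b); split; lra.
Qed.

End compatible_metric.

(** * From an expansive quotient to a semi expansive metric *)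

Lemma quotient_iterz (M : topologicalType) (E : equiv_rel M) (f : homeo M)
    (Ef : compatible_rel E f) (n : int) (x : M) :
  iterz (quotient_homeo Ef) n (quotient_pi E x) = quotient_pi E (iterz f n x).
Proof.
have invE y : homeo_inv (quotient_homeo Ef) (quotient_pi E y) =
    quotient_pi E (homeo_inv f y).
  by rewrite -{1}(homeo_invK f y) -(quotient_homeo_pi Ef) homeo_funK.
case: n => n; rewrite /iterz.
  by elim: n => // n IH; rewrite !iterS IH quotient_homeo_pi.
by elim: n.+1 => // {}n IH; rewrite !iterS IH invE.
Qed.

Lemma lewowicz_of_expansive (R : realType) (M : topologicalType)
    (metrizableM : metrizable R M)
    (f : homeo M) (E : equiv_rel M) (Ef : compatible_rel E f) :
  expansive R (quotient_homeo Ef) -> lewowicz_quotient R E f.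
Proof.
move=> [rho crho [alpha a0 exprho]]; have [D cD] := metrizableM.
have [[rho0 rhoI rhoC rhoD] _] := crho; have [[D0 DI DC DD] oD] := cD.
have rho_ge0 x y : 0 <= rho x y by apply: is_metric_ge0; case: crho.
have D_ge0 x y : 0 <= D x y by apply: is_metric_ge0; case: cD.
pose pi := quotient_pi E.
(* [m] separates points inside a class, where the [rho] term vanishes, while the cap [alpha / 4]
   keeps [d] below [alpha / 2] there. *)
pose m x y := Num.min (D x y) (alpha / 4).
have m_ge0 x y : 0 <= m x y by rewrite /m le_min D_ge0; lra.
have mD x y : m x y <= D x y by rewrite /m ge_min lexx.
have ma x y : m x y <= alpha / 4 by rewrite /m ge_min lexx orbT.
pose d x y := rho (pi x) (pi y) + m x y.
have iterE n x y : E x y -> pi (iterz f n x) = pi (iterz f n y).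
  by move=> /quotient_piP Exy; rewrite /pi -!(quotient_iterz Ef) Exy.
have closeE x y : E x y <-> orbit_close f d alpha x y.
  split=> [Exy n|xy].
    rewrite /d (iterE n _ _ Exy) rho0 add0r.
    by have := ma (iterz f n x) (iterz f n y); lra.
  apply/quotient_piP; apply: exprho => n; rewrite !quotient_iterz.
  have := xy n; have := m_ge0 (iterz f n x) (iterz f n y).
  by rewrite /d/pi; lra.
exists d; last first.
  exists alpha => //; split=> // x y /closeE /(iterE 0) /= Exy.
  by rewrite /d Exy rho0; have := ma x y; lra.
split; first split.
- by move=> x; rewrite /d /m rho0 D0 add0r min_l//; lra.
- move=> x y dxy; apply: DI.
  have : m x y = 0.
    have := m_ge0 x y; have := rho_ge0 (pi x) (pi y).
    by move: dxy; rewrite /d; lra.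
  by rewrite /m minEle; case: ifP => // _; lra.
- by move=> x y; rewrite /d /m rhoC DC.
- move=> y x z; rewrite /d addrACA lerD//.
  have := DD y x z; have := D_ge0 x y; have := D_ge0 y z.
  by rewrite /m !minEle; do 3!case: ifPn; rewrite -?ltNge; lra.
move=> A; split=> [/oD oA x /oA[r r0 rA]|dA].
  (* [d x y < alpha / 4] rules out the truncated value of [m], so that [D x y < r]. *)
  exists (Num.min r (alpha / 4)); first by rewrite lt_min r0; lra.
  move=> y /= dr; apply: rA => /=; have := rho_ge0 (pi x) (pi y).
  move: dr; rewrite /d /m lt_min => /andP[].
  by rewrite minEle; case: ifPn; rewrite -?ltNge; lra.
(* Continuity of the projection makes the [rho] term small near [x]. *)
rewrite openE => x /dA[r r0 rA]; rewrite /interior.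
have r2 : 0 < r / 2 by lra.
have rx : \forall y \near x, rho (pi x) (pi y) < r / 2.
  exact: (@pi_continuous M _ x _ (nbhs_metric_ball crho (pi x) r2)).
apply: filterS (filterI rx (nbhs_metric_ball cD x r2)) => y [/= xy Dxy].
apply: rA => /=; rewrite /d; have := mD x y; lra.
Qed.

(** * Finite orbit windows *)

Section window.
Context {R : realType} {M : topologicalType}.
Variables (f : homeo M) (d : M -> M -> R) (alpha : R).

(* The pairs staying alpha-close during the times -n, ..., n. *)
Fixpoint close_window n (x y : M) : Prop :=
  if n is n'.+1 then
    [/\ close_window n' x y, close_window n' (f x) (f y) &
        close_window n' (homeo_inv f x) (homeo_inv f y)]
  else d x y <= alpha.

Lemma close_window_le n m x y :
  (n <= m)%N -> close_window m x y -> close_window n x y.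
Proof.
elim: m => [|m IH]; first by rewrite leqn0 => /eqP->.
by rewrite leq_eqVlt => /predU1P[->//|/IH {}IH [/IH]].
Qed.

Lemma orbit_close_window x y :
  (forall n, close_window n x y) -> orbit_close f d alpha x y.
Proof.
move=> xy [n|n] /=; rewrite -?iterS.
  move: x y {xy}(xy n); elim: n => //= n IH x y [_ + _] => /IH.
  by rewrite -!iterSr.
(* [Negz n] is the time -(n+1), so window [n.+1] is needed. *)
move: x y {xy}(xy n.+1); elim: n.+1 => // {}n IH x y [_ _] /IH.
by rewrite -!iterSr.
Qed.

(** [E] is invariant under [f] and its inverse, so the bound at time 0 propagates along the
    orbit. *)
Lemma close_window_rel (E : equiv_rel M) n x y : compatible_rel E f ->
  (forall x y, E x y -> d x y <= alpha) -> E x y -> close_window n x y.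
Proof.
move=> Ef Ed; elim: n x y => [|n IH] x y Exy /=; first exact: Ed.
split; apply: IH => //; first exact: (Ef _ _).1.
by apply/Ef; rewrite !homeo_invK.
Qed.

Hypothesis cd : compatible_metric d.

Lemma close_window_sym n x y : close_window n x y -> close_window n y x.
Proof.
have [[_ _ dC _] _] := cd.
by elim: n x y => [|n IH] x y /=; [rewrite dC|case=> /IH ? /IH ? /IH].
Qed.

Lemma close_window_closed n :
  closed [set p : M * M | close_window n p.1 p.2].
Proof.
elim: n => [|n IH] /=.
  exact: ((continuous_closedP _).1 (metric_continuous cd) _
    (@closed_le _ alpha)).
have hclosed (h : M -> M) : continuous h ->
    closed [set p : M * M | close_window n (h p.1) (h p.2)].
  move=> ch.
  apply: ((continuous_closedP (fun p : M * M => (h p.1, h p.2))).1 _ _ IH).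
  move=> [a b]; apply: cvg_pair => /=.
    by apply: (cvg_comp _ _ cvg_fst); exact: ch.
  by apply: (cvg_comp _ _ cvg_snd); exact: ch.
have := closedI IH (closedI (hclosed _ (@homeo_fun_continuous _ f))
                            (hclosed _ (@homeo_inv_continuous _ f))).
by congr (closed _); apply/seteqP; split=> p /= => [[? []]|[]].
Qed.

Hypothesis a0 : 0 < alpha.

Lemma close_window_refl n x : close_window n x x.
Proof.
have [[d0 _ _ _] _] := cd.
by elim: n x => [|n IH] x /=; [rewrite d0 ltW|split].
Qed.

Lemma nbhs_close_window n x : nbhs x [set y | close_window n x y].
Proof.
elim: n x => [|n IH] x /=.
  apply: filterS (nbhs_metric_ball cd x a0) => y /=; exact: ltW.
have ff : \forall y \near x, close_window n (f x) (f y).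
  exact: (@homeo_fun_continuous _ f x _ (IH (f x))).
have fi : \forall y \near x, close_window n (homeo_inv f x) (homeo_inv f y).
  exact: (@homeo_inv_continuous _ f x _ (IH (homeo_inv f x))).
by apply: filterS (filterI (IH x) (filterI ff fi)) => y /= [? []].
Qed.

Hypothesis compactM : compact [set: M].
Hypothesis sf : semi_expansive f d alpha.

(** Otherwise the closed sets [F n] in the compact square would share a pair, orbit-close yet at
    distance at least [alpha / 2]. *)
Lemma semi_expansive_window :
  exists N, forall x y, close_window N x y -> d x y < alpha / 2.
Proof.
apply: contrapT => /forallNP noN.
pose F n := [set p : M * M | close_window n p.1 p.2] `&`
            [set p : M * M | alpha / 2 <= d p.1 p.2].
have [p Fp] : exists p, forall n, F n p.
  apply: compact_bigcap_neq0.
  - by rewrite -setXTT; exact: compact_setX.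
  - move=> n; apply: closedI; first exact: close_window_closed.
    exact: ((continuous_closedP _).1 (metric_continuous cd) _
      (@closed_ge _ (alpha / 2))).
  - by move=> n p [[]].
  - move=> n; have /existsNP[x /existsNP[y /not_implyP[xy /negP]]] := noN n.
    by rewrite -leNgt => dxy; exists (x, y).
have /sf : orbit_close f d alpha p.1 p.2.
  by apply: orbit_close_window => n; have [] := Fp n.
by have [_ /=] := Fp 0%N; rewrite leNgt => /negbTE ->.
Qed.

(** Around each time in -n, ..., n there is room for a window of size [N], so both distances are
    below [alpha / 2] at that time and add up to less than [alpha]. *)
Lemma close_window_trans N n x y z :
  (forall x y, close_window N x y -> d x y < alpha / 2) ->
  close_window (n + N) x y -> close_window (n + N) y z -> close_window n x z.
Proof.
move=> dN; have [[_ _ _ dD] _] := cd.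
elim: n x y z => [|n IH] x y z.
  by move=> /dN xy /dN yz /=; have := dD y x z; lra.
by move=> [? ? ?] [? ? ?]; split; [apply: (IH x y)|apply: (IH _ (f y))|
  apply: (IH _ (homeo_inv f y))].
Qed.

End window.

(** * From a semi expansive metric to an expansive quotient *)

Lemma expansive_of_lewowicz (R : realType) (M : topologicalType)
    (compactM : compact [set: M])
    (f : homeo M) (E : equiv_rel M) (Ef : compatible_rel E f) :
  lewowicz_quotient R E f -> expansive R (quotient_homeo Ef).
Proof.
move=> [d cd [alpha a0 [sf Eclose]]].
pose U := close_window f d alpha.
(* N is taken positive so that the windows of size n * N are cofinal. *)
have [N N0 dN] : exists2 N, (0 < N)%N &
    forall x y, U N x y -> d x y < alpha / 2.
  have [N dN] := semi_expansive_window cd compactM sf.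
  by exists N.+1 => // x y [/dN].
have UE x y : (forall n, U n x y) <-> E x y.
  split=> [/orbit_close_window xy|Exy n]; first exact/Eclose.
  by apply: close_window_rel Ef _ Exy => x' y' /Eclose/(_ 0).
(* Steps of length [N] turn [close_window_trans] into the splitting condition of the base. *)
have [|||delta [delta0 deltaC deltaD deltaU Udelta]] :=
    @pseudometric_of_countable_base R M (fun n => U (n * N)%N).
- by move=> n x; exact: close_window_refl.
- by move=> n x y; exact: close_window_sym.
- by move=> n x y z; rewrite mulSn addnC; exact: close_window_trans.
have {}deltaU n : exists2 r, 0 < r & forall x y, delta x y < r -> U n x y.
  have [r r0 rU] := deltaU n; exists r => // x y /rU.
  by apply: close_window_le; rewrite leq_pmulr.
have delta_ge0 x y : 0 <= delta x y.
  by have := deltaD y x x; rewrite delta0 (deltaC y x); lra.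
(* The zero set of [delta] is the intersection of the windows, so [rho] below separates classes. *)
have delta_eq0 x y : delta x y = 0 <-> E x y.
  split=> [xy0|/UE Uxy].
    apply/UE => n; have [r r0 /(_ x y)] := deltaU n.
    by rewrite xy0; exact.
  apply/eqP; rewrite eq_le delta_ge0 andbT leNgt; apply/negP => xy0.
  by have [n /(_ x y (Uxy _))] := Udelta _ xy0; rewrite ltxx.
pose pi := quotient_pi E.
pose rho (a b : quotient_space E) := delta (repr a) (repr b).
have repE x : E (repr (pi x)) x by apply/quotient_piP; rewrite quotient_piK.
(* A chosen representative is at [delta]-distance 0 from its point, so the triangle inequality gives
   independence of the choice. *)
have rhoE x y : rho (pi x) (pi y) = delta x y.
  have /delta_eq0 x0 := repE x; have /delta_eq0 y0 := repE y; rewrite /rho.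
  have := deltaD x (repr (pi x)) (repr (pi y)).
  have := deltaD (repr (pi x)) x y; have := deltaD y x (repr (pi y)).
  have := deltaD (repr (pi y)) (repr (pi x)) y.
  by rewrite (deltaC x (repr (pi x))) (deltaC y (repr (pi y))) x0 y0; lra.
exists rho.
  split; first split.
  - by move=> a; exact: delta0.
  - move=> a b /delta_eq0/quotient_piP; by rewrite !quotient_piK.
  - by move=> a b; exact: deltaC.
  - by move=> b a c; exact: deltaD.
  move=> A; split=> [oA a|rA].
    rewrite -[a]quotient_piK -/pi; move: (repr a) => {a} x Ax.
    suff [n xA] : exists n, forall y, U n x y -> A (pi y).
      have [r r0 rU] := deltaU n; exists r => // b /=.
      by rewrite -[b]quotient_piK -/pi rhoE => /rU; exact: xA.
    (* Otherwise the closed sets of points of [U n x] projecting outside [A] share a point [p]; it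
       is equivalent to [x], so [pi p] is in [A] after all. *)
    apply: contrapT => /forallNP noA.
    have [p xp] : exists p, forall n, (U n x p /\ ~ A (pi p)).
      apply: (@compact_bigcap_neq0 _ (fun n => [set y | U n x y /\ ~ A (pi y)]))
        => // [n|n y [[? ? ?] ?] //|n].
        apply: closedI.
          have cx : continuous (fun y : M => (x, y)).
            by move=> y; apply: cvg_pair; [exact: cvg_cst|exact: cvg_id].
          exact: ((continuous_closedP _).1 cx _
            (@close_window_closed _ _ f d alpha cd n)).
        by apply: open_closedC; exact: oA.
      by have /existsNP[y /not_implyP[]] := noA n; exists y.
    have /UE/quotient_piP pE : forall n, U n x p by move=> n; have [] := xp n.
    by have [_] := xp 0%N; rewrite /pi -pE.
  change (open (pi @^-1` A)); rewrite openE => x /rA[r r0 rxA].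
  have [n nr] := Udelta _ r0.
  apply: filterS (nbhs_close_window f cd a0 (n * N) x) => y /= /nr xyr.
  by apply: rxA; rewrite /= rhoE.
(* Window 0 is [d x y <= alpha]; halving [r] turns the non-strict bound of expansivity into the
   strict one required by [rU]. *)
have [r r0 rU] := deltaU 0%N.
exists (r / 2); first lra.
move=> a b; rewrite -[a]quotient_piK -[b]quotient_piK.
move: (repr a) (repr b) => {a b} x y xy; apply/quotient_piP/Eclose => n.
have := xy n; rewrite !quotient_iterz rhoE => xyn.
by have /= := rU (iterz f n x) (iterz f n y); apply; lra.
Qed.

Theorem theorem3p10 (R : realType) (M : topologicalType)
    (compactM : compact [set: M]%classic) (metrizableM : metrizable R M)
    (f : homeo M) (E : equiv_rel M) (Ef : compatible_rel E f) :
  expansive R (quotient_homeo Ef) <-> lewowicz_quotient R E f.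
Proof.
split; first exact: lewowicz_of_expansive.
exact: expansive_of_lewowicz.
Qed.
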